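(* Let $k\ge 1$ and let $(X,\sigma,\tau)$ be a left non-degenerate $k$-permutational solution. Then the map $U\colon X\to X$, $U(x)=\sigma_x^{-1}(x)$, is invertible and, for every $x\in X$, $$U^{-1}(x)=\Omega_k(\underbrace{\sigma,\ldots,\sigma}_{k},\underbrace{x,\ldots,x}_{k+1}).$$
   Context: A (set-theoretic) solution (of the Yang-Baxter equation) $(X,\sigma,\tau)$ is a set $X$ (of arbitrary cardinality) with maps $\sigma,\tau\colon X^2\to X$ such that, writing $\sigma_x(y)=\sigma(x,y)$ and $\tau_y(x)=\tau(x,y)$, the map $r\colon X^2\to X^2$, $r(x,y)=(\sigma_x(y),\tau_y(x))$ satisfies the braid relation $(\mathrm{id}\times r)(r\times \mathrm{id})(\mathrm{id}\times r)=(r\times \mathrm{id})(\mathrm{id}\times r)(r\times \mathrm{id})$ on $X^3$. It is left non-degenerate if all $\sigma_x$ ($x\in X$) are bijections of $X$ (the $\tau_y$ need not be bijections). Terms $\Omega_i$: for families of maps $\gamma^{(j)}=(\gamma^{(j)}_x\colon X\to X)_{x\in X}$ put $\Omega_0(x)=x$ and, for $i\ge 1$, $$\Omega_i(\gamma^{(i)},\ldots,\gamma^{(1)},x,z_1,\ldots,z_i)=\gamma^{(i)}_{\Omega_{i-1}(\gamma^{(i-1)},\ldots,\gamma^{(1)},x,z_1,\ldots,z_{i-1})}(z_i).$$ A solution is $k$-permutational if $\Omega_k(\gamma^{(k)},\ldots,\gamma^{(1)},x,z_1,\ldots,z_k)=\Omega_k(\gamma^{(k)},\ldots,\gamma^{(1)},y,z_1,\ldots,z_k)$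 for all $x,y,z_1,\ldots,z_k\in X$ and all $(\gamma^{(1)},\ldots,\gamma^{(k)})\in\{\sigma,\tau\}^k$. *)

(* Defs.v *)
From mathcomp Require Import all_boot.
From mathcomp Require Import boolp classical_sets functions.

Set Implicit Arguments.
Unset Strict Implicit.
Unset Printing Implicit Defensive.

Definition inverse (X : Type) (f : X -> X) (f_bij : bijective f) : X -> X :=
  (bijection_of_bijective f_bij)^-1%FUN.

Lemma inverseK (X : Type) (f : X -> X) (f_bij : bijective f) :
  cancel f (inverse f_bij).
Proof.
by move=> x; apply: (funK (s := bijection_of_bijective f_bij)); rewrite inE.
Qed.

Lemma inverseKV (X : Type) (f : X -> X) (f_bij : bijective f) :
  cancel (inverse f_bij) f.
Proof.
have [g _ gK] := f_bij.
by move=> x; rewrite -[x in LHS]gK inverseK.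
Qed.

Definition solution_map (X : Type) (sigma tau : X -> X -> X) (p : X * X) :
  X * X := (sigma p.1 p.2, tau p.1 p.2).

Definition r_times_id (X : Type) (r : X * X -> X * X) (t : X * X * X) :
  X * X * X :=
  let: (x, y, z) := t in let: (x', y') := r (x, y) in (x', y', z).

Definition id_times_r (X : Type) (r : X * X -> X * X) (t : X * X * X) :
  X * X * X :=
  let: (x, y, z) := t in let: (y', z') := r (y, z) in (x, y', z').

Definition is_solution (X : Type) (sigma tau : X -> X -> X) : Prop :=
  let r := solution_map sigma tau in
  id_times_r r \o r_times_id r \o id_times_r r
  =1 r_times_id r \o id_times_r r \o r_times_id r.

Definition left_nondegenerate (X : Type) (sigma : X -> X -> X) : Prop :=
  forall x, bijective (sigma x).

(* A family gamma = (gamma_x : X -> X) is curried with its index x first.  So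
   the binary operation sigma is itself the family (sigma_x), whereas the
   family (tau_y), given by tau_y(x) = tau(x, y), is the flip of tau. *)
Definition tau_family (X : Type) (tau : X -> X -> X) : X -> X -> X :=
  fun y x => tau x y.

(* Omega gamma x z i is Omega_i(gamma^(i), ..., gamma^(1), x, z_1, ..., z_i).
   Both sequences are total on nat for convenience, but only the entries with
   indices 1, ..., i are used. *)
Fixpoint Omega (X : Type) (gamma : nat -> X -> X -> X) (x : X) (z : nat -> X)
    (i : nat) : X :=
  if i is j.+1 then gamma j.+1 (Omega gamma x z j) (z j.+1) else x.

Definition permutational (X : Type) (sigma tau : X -> X -> X) (k : nat) :
  Prop :=
  forall gamma : nat -> X -> X -> X,
    (forall j, 1 <= j <= k -> gamma j = sigma \/ gamma j = tau_family tau) ->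
  forall (x y : X) (z : nat -> X), Omega gamma x z k = Omega gamma y z k.

Definition U_map (X : Type) (sigma : X -> X -> X)
    (sigma_bij : left_nondegenerate sigma) (x : X) : X :=
  inverse (sigma_bij x) x.

(* Main.v *)
(* Write V x for the right-hand side. Permutationality makes
   Omega_k(sigma, ..., sigma, y, x, ..., x) independent of y. Starting from
   y = sigma_x(x) gives sigma_(V x)(x) = V x, that is U (V x) = x; and since
   sigma_x(U x) = x, starting from y = x with all z_i = U x gives
   V (U x) = x. *)
Require Import Defs.
From mathcomp Require Import all_boot.

Lemma Omega_const_iter (X : Type) (g : X -> X -> X) (x z : X) (k : nat) :
  Omega (fun _ => g) x (fun _ => z) k = iter k (g^~ z) x.
Proof. by elim: k => //= k ->. Qed.

Theorem proposition4p10 (X : Type) (sigma tau : X -> X -> X) (k : nat)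
    (k_ge1 : 1 <= k)
    (sol : is_solution sigma tau)
    (sigma_bij : left_nondegenerate sigma)
    (perm : permutational sigma tau k) :
  exists U_bij : bijective (U_map sigma_bij),
    forall x : X, inverse U_bij x = Omega (fun _ => sigma) x (fun _ => x) k.
Proof.
have iter_perm x y z : iter k (sigma^~ z) x = iter k (sigma^~ z) y.
  by rewrite -!Omega_const_iter; apply: perm => j _; left.
pose V x := iter k (sigma^~ x) x.
have UK : cancel (U_map sigma_bij) V.
  move=> x; rewrite /V (iter_perm _ x).
  by apply: iter_fix; apply: inverseKV.
have VK : cancel V (U_map sigma_bij).
  move=> x; rewrite /U_map; have sVx : sigma (V x) x = V x.
    (* The extra application moves to the starting point: both sides become [k]-fold iterates of
       [sigma^~ x], from [sigma x x] and from [x]. *)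
    by rewrite -[LHS]/(iter k.+1 (sigma^~ x) x) iterSr; apply: iter_perm.
  (* Only the argument is rewritten; the index [V x] of [sigma_bij] stays, so that [inverse] meets
     [sigma (V x)]. *)
  by rewrite -[X in inverse _ X]sVx inverseK.
have U_bij : bijective (U_map sigma_bij) by exists V.
exists U_bij => x; rewrite Omega_const_iter -/(V x).
(* [inverse U_bij] is not [V] by definition; writing [x] as the image of [V x] identifies their
   values. *)
by rewrite -{1}[x]VK inverseK.
Qed.
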